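(* The maj-Wilf equivalence classes of single permutations satisfy $$[123]_{\mathrm{maj}}=\{123\},\qquad [321]_{\mathrm{maj}}=\{321\},\qquad [132]_{\mathrm{maj}}=\{132,231\},\qquad [213]_{\mathrm{maj}}=\{213,312\},$$ and these are all the maj-Wilf equivalence classes involving single elements of $\mathfrak S_3$.
   Context: $\mathfrak S_n$ is the set of permutations $\sigma=a_1a_2\ldots a_n$ of $[n]=\{1,\dots,n\}$ in one-line notation, and $\mathfrak S=\bigcup_{n\ge0}\mathfrak S_n$. A permutation $\sigma$ contains $\pi\in\mathfrak S_k$ as a pattern if some subsequence of $\sigma$ of length $k$ is order isomorphic to $\pi$ (has its entries in the same relative order); otherwise $\sigma$ avoids $\pi$. $\mathrm{Av}_n(\pi)$ is the set of $\sigma\in\mathfrak S_n$ avoiding $\pi$. The major index is $\mathrm{maj}\,\sigma=\sum_{i:\,a_i>a_{i+1}} i$, and $M_n(\pi;q)=\sum_{\sigma\in \mathrm{Av}_n(\pi)}q^{\mathrm{maj}\,\sigma}$. Permutations $\pi,\pi'$ are maj-Wilf equivalent if $M_n(\pi;q)=M_n(\pi';q)$ for all $n\ge0$; $[\pi]_{\mathrm{maj}}$ denotes the set of single permutations $\pi'\in\mathfrak S$ that are maj-Wilf equivalent to $\pi$. *)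

(* Defs.v *)
From mathcomp Require Import all_boot ssralg ssrint poly perm.
From mathcomp Require Import boolp classical_sets.

Set Implicit Arguments.
Unset Strict Implicit.
Unset Printing Implicit Defensive.

(* A permutation of [n] is an element of 'S_n; positions and values are
   0-based in 'I_n, and [oneline] gives the usual 1-based word a_1 ... a_n. *)
Definition oneline n (s : 'S_n) : seq nat := [seq (s i).+1 | i <- enum 'I_n].

Definition contains n k (s : 'S_n) (p : 'S_k) : bool :=
  [exists f : {ffun 'I_k -> 'I_n},
    [forall i : 'I_k, forall j : 'I_k, (i < j) ==> (f i < f j)] &&
    [forall i : 'I_k, forall j : 'I_k, (p i < p j) == (s (f i) < s (f j))]].

Definition Av n k (p : 'S_k) : {set 'S_n} := [set s : 'S_n | ~~ contains s p].

(* The entry a_i is [nth 0 (oneline s) i.-1]. *)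
Definition maj n (s : 'S_n) : nat :=
  \sum_(1 <= i < n | nth 0 (oneline s) i < nth 0 (oneline s) i.-1) i.

Definition M n k (p : 'S_k) : {poly int} :=
  (\sum_(s in Av n p) 'X^(maj s))%R.

Definition permutation : Type := {n : nat & 'S_n}.

Definition perm_in n (p : 'S_n) : permutation := Tagged (fun m => 'S_m) p.

Definition maj_wilf (p p' : permutation) : Prop :=
  forall n, M n (tagged p) = M n (tagged p').

Definition maj_class (p : permutation) : set permutation :=
  [set p' | maj_wilf p p']%classic.

Definition perm_of_tuple n (t : n.-tuple 'I_n) (t_uniq : uniq t) : 'S_n :=
  perm (elimT (tuple_uniqP t) t_uniq).

Definition v1 : 'I_3 := @Ordinal 3 0 isT.
Definition v2 : 'I_3 := @Ordinal 3 1 isT.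
Definition v3 : 'I_3 := @Ordinal 3 2 isT.

Definition s123 : 'S_3 := @perm_of_tuple 3 [tuple v1; v2; v3] isT.
Definition s132 : 'S_3 := @perm_of_tuple 3 [tuple v1; v3; v2] isT.
Definition s213 : 'S_3 := @perm_of_tuple 3 [tuple v2; v1; v3] isT.
Definition s231 : 'S_3 := @perm_of_tuple 3 [tuple v2; v3; v1] isT.
Definition s312 : 'S_3 := @perm_of_tuple 3 [tuple v3; v1; v2] isT.
Definition s321 : 'S_3 := @perm_of_tuple 3 [tuple v3; v2; v1] isT.

Definition p123 : permutation := perm_in s123.
Definition p132 : permutation := perm_in s132.
Definition p213 : permutation := perm_in s213.
Definition p231 : permutation := perm_in s231.
Definition p312 : permutation := perm_in s312.
Definition p321 : permutation := perm_in s321.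

Lemma oneline_perm_of_tuple n (t : n.-tuple 'I_n) (t_uniq : uniq t) :
  oneline (perm_of_tuple t_uniq) = [seq (val i).+1 | i <- t].
Proof.
rewrite -[in RHS](map_tnth_enum t) -map_comp.
by apply: eq_map => i /=; rewrite permE.
Qed.

Lemma oneline_S3 :
  [/\ oneline s123 = [:: 1; 2; 3], oneline s132 = [:: 1; 3; 2]
    & oneline s213 = [:: 2; 1; 3]] /\
  [/\ oneline s231 = [:: 2; 3; 1], oneline s312 = [:: 3; 1; 2]
    & oneline s321 = [:: 3; 2; 1]].
Proof. by split; split; rewrite oneline_perm_of_tuple. Qed.

(* Main.v *)
Require Import Defs.
From mathcomp Require Import all_boot ssralg ssrint poly perm.
From mathcomp Require Import boolp classical_sets.
From mathcomp Require Import fingroup zify.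

(** Two sources of information decide the classes.

    Separation.  Among the permutations of size at most [n], a pattern of size
    [n] is contained in itself only, so at its own size its polynomial is the
    full generating function of maj minus one monomial ([M_diag]); below that
    size nothing is removed ([M_short]).  Hence maj-Wilf equivalent
    permutations have the same size and the same major index.  On S_3 the major
    index is 0 on 123, 1 on 213 and 312, 2 on 132 and 231, and 3 on 321, so the
    classes are at most the sets of the theorem.

    Equivalence.  Write a nonempty word as L m R with m its maximum.  It avoids
    132 iff L and R do and all of L is above R; it avoids 231 iff L and R do
    and all of L is below R.  In both cases the sizes of L and R and the two
    smaller words are arbitrary, and the descents are those of L, those of R,
    and one at m if R is nonempty.  So an avoider in either class is the same
    thing as a shape of decreasing binary tree, and the shape determines the
    descent set, hence maj.

    The proof uses the shape without building trees: it is the data, for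
    positions i <= j, of whether the entry at j exceeds all entries at
    positions i, ..., j-1 ([record_from]).  Every permutation is
    retracted onto the 132-avoider of the same shape ([to132]) and onto
    the 231-avoider of the same shape ([to231]); the avoiders are the fixed
    points, each retraction forgets everything but the shape, and descents are
    kept.  The two retractions therefore restrict to mutually inverse bijections
    preserving maj.  Complementation turns this into the
    equivalence of 312 and 213. *)

Set Implicit Arguments.
Unset Strict Implicit.
Unset Printing Implicit Defensive.

Local Open Scope classical_set_scope.

(** * Permutations and linear orders on positions *)

Lemma containsP {n k} (s : 'S_n) (p : 'S_k) :
  reflect (exists2 f : 'I_k -> 'I_n, forall i j : 'I_k, i < j -> f i < f j
             & forall i j, (p i < p j) = (s (f i) < s (f j)))
          (contains s p).
Proof.
apply: (iffP existsP) => [[f /andP[fM fP]]|[f fM fP]].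
  exists f => i j; first by move: fM => /'forall_'forall_implyP /(_ i j).
  by move: fP => /'forall_forallP /(_ i j) /eqP.
exists (finfun f); apply/andP; split; apply/'forall_forallP => i j; rewrite !ffunE.
  exact/implyP/fM.
exact/eqP/fP.
Qed.

Lemma card_ord_lt n (m : 'I_n) : #|[set j : 'I_n | j < m]%SET| = m.
Proof.
rewrite cardsE -sum1_card /= (big_ord_narrow (ltnW (ltn_ord m))).
by rewrite sum1_card card_ord.
Qed.

Lemma card_perm_lt n (s : 'S_n) i : #|[set j | s j < s i]%SET| = s i.
Proof.
rewrite -[RHS]card_ord_lt -(card_preimset [set j : 'I_n | j < s i]%SET (@perm_inj _ s)).
by apply: eq_card => j; rewrite !inE.
Qed.

(** The value [s i] can be recovered from the order as the number of smaller
    entries. *)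
Lemma perm_order_inj n (s t : 'S_n) :
  (forall i j, (s i < s j) = (t i < t j)) -> s = t.
Proof.
move=> st; apply/permP => i; apply/val_inj; rewrite /= -(card_perm_lt s i) -(card_perm_lt t i).
by apply: eq_card => j; rewrite !inE st.
Qed.

Lemma perm_ltN n (s : 'S_n) (i j : 'I_n) :
  i != j -> (s j < s i) = ~~ (s i < s j).
Proof.
move=> ij; have: s i != s j by rewrite (inj_eq perm_inj).
by rewrite -(inj_eq val_inj) /=; lia.
Qed.

Lemma perm_ascents_inj n (s t : 'S_n) :
  (forall i j : 'I_n, i < j -> (s i < s j) = (t i < t j)) -> s = t.
Proof.
move=> st; apply: perm_order_inj => i j; case: (ltngtP i j) => [/st //|ji|/val_inj ->].
  have jDi : j != i by rewrite -(inj_eq val_inj) ltn_eqF.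
  by rewrite perm_ltN // [RHS]perm_ltN // st.
by rewrite !ltnn.
Qed.

(** The hypotheses say that the ascent pairs and the inversion pairs are both
    transitive.  Orienting each pair of positions accordingly gives a
    tournament without 3-cycles, hence a linear order, and each position is
    sent to its rank. *)
Lemma perm_of_ascents n (up : rel 'I_n) :
    (forall i j k : 'I_n, i < j < k -> up i j -> up j k -> up i k) ->
    (forall i j k : 'I_n, i < j < k -> up i k -> up i j || up j k) ->
  {t : 'S_n | forall i j : 'I_n, i < j -> (t i < t j) = up i j}.
Proof.
move=> upT upC.
pose r (i j : 'I_n) := if (i < j)%N then up i j else (j < i)%N && ~~ up j i.
have rirr i : r i i = false by rewrite /r ltnn.
have rN (i j : 'I_n) : i != j -> r j i = ~~ r i j.
  by rewrite -(inj_eq val_inj) /r; case: ltngtP => //=; rewrite negbK.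
have rT j i k : r i j -> r j k -> r i k.
  rewrite /r.
  case: (ltngtP i j) => [ij|ji|//]; case: (ltngtP j k) => [jk|kj|/val_inj <-] //=.
  - by rewrite (ltn_trans ij jk); apply: upT; rewrite ij.
  - case: (ltngtP i k) => [ik|ki|/val_inj ik] //=.
    + move=> uij ukj; have /upC/(_ uij) : i < k < j by rewrite ik.
      by rewrite (negPf ukj) orbF.
    + move=> uij; apply: contra => uki; apply: upT uki uij; rewrite ?ki //.
    + by rewrite ik => ->.
  - case: (ltngtP i k) => [ik|ki|/val_inj ik] //=.
    + by move=> uji ujk; have /upC/(_ ujk) : j < i < k by [rewrite ji]; rewrite (negPf uji).
    + move=> uji ujk; apply: contra uji => uki; apply: upT ujk uki; rewrite ?jk //.
    + by move=> uji; rewrite -ik (negPf uji).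
  - rewrite ltnNge (ltnW (ltn_trans kj ji)) /= (ltn_trans kj ji) => uji ukj.
    apply/negP => uki; have /upC/(_ uki) : k < j < i by rewrite kj.
    by rewrite (negPf uji) (negPf ukj).
pose rank (i : 'I_n) := #|[set j | r j i]%SET|.
have rank_lt i j : r i j -> rank i < rank j.
  move=> rij; apply: proper_card; apply/fintype.properP; split.
    by apply/fintype.subsetP => k; rewrite !inE => /rT; apply.
  by exists i; rewrite inE ?rirr.
have rank_bound i : rank i < n.
  rewrite -[X in _ < X](card_ord n) -cardsT; apply: proper_card.
  by rewrite properT; apply/negP => /eqP/setP/(_ i); rewrite !inE rirr.
have rankE i j : (rank i < rank j) = r i j.
  apply/idP/idP => [|/rank_lt //]; apply: contraTT => rij.
  have [->|iDj] := eqVneq i j; first by rewrite ltnn.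
  by rewrite -leqNgt ltnW // rank_lt // rN.
have rank_inj : injective (fun i => Ordinal (rank_bound i)).
  move=> i j [] e; apply/eqP/negPn/negP => iDj; have := rN i j iDj.
  by rewrite -!rankE e ltnn.
by exists (perm rank_inj) => i j ij; rewrite !permE /= rankE /r ij.
Qed.

(** * Retractions onto the 132-avoiders and the 231-avoiders *)

(** As [i] and [j] vary, this relation encodes the shape of the decreasing
    binary tree of [s]. *)
Definition record_from n (s : 'S_n) (i j : 'I_n) : bool :=
  [forall k : 'I_n, (i <= k < j) ==> (s k < s j)].

Lemma record_fromP {n} {s : 'S_n} {i j : 'I_n} :
  reflect (forall k : 'I_n, i <= k < j -> s k < s j) (record_from s i j).
Proof. exact: (iffP 'forall_implyP). Qed.

Lemma to132_exists n (s : 'S_n) :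
  {t : 'S_n | forall i j : 'I_n, i < j -> (t i < t j) = record_from s i j}.
Proof.
apply: perm_of_ascents => i j k /andP[ij jk].
  move=> /record_fromP uij /record_fromP ujk; apply/record_fromP => l /andP[il lk].
  have [jl|lj] := leqP j l; first by rewrite ujk ?jl.
  by apply: (ltn_trans (uij l _) (ujk j _)); rewrite ?il ?leqnn.
move=> /record_fromP uik; apply/orP; right; apply/record_fromP => l /andP[jl lk].
by rewrite uik // lk (leq_trans (ltnW ij)).
Qed.

(** The 132-avoider of the same shape: in a 132-avoider, a later entry is larger
    than an earlier one only if it beats everything between them. *)
Definition to132 n (s : 'S_n) : 'S_n := sval (to132_exists s).

Lemma to132E n (s : 'S_n) (i j : 'I_n) :
  i < j -> (to132 s i < to132 s j) = record_from s i j.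
Proof. exact: (svalP (to132_exists s)). Qed.

(** Multiplying by [rev_perm] on the left reverses a word, and on the right
    complements it. *)
Definition rev_perm n : 'S_n := perm (@rev_ord_inj n).

Lemma rev_permK n : (rev_perm n * rev_perm n)%g = 1%g.
Proof. by apply/permP => i; rewrite permM !permE rev_ordK. Qed.

(** Since 231 is the reversal of 132, conjugating by reversal gives the
    231-avoider of the same shape. *)
Definition to231 n (s : 'S_n) : 'S_n := (rev_perm n * to132 (rev_perm n * s))%g.

Lemma rev_perm_lt n (i j : 'I_n) : (rev_perm n i < rev_perm n j) = (j < i).
Proof. rewrite !permE /=; have := ltn_ord i; have := ltn_ord j; lia. Qed.

Lemma ltn_ord_neq n (i j : 'I_n) : i < j -> i != j.
Proof. by move=> ij; rewrite -(inj_eq val_inj) ltn_eqF. Qed.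

(** Mirror image of [to132E]: an inversion of a 231-avoider is a pair whose
    earlier entry is the maximum of the interval that the pair spans. *)
Lemma to231P n (s : 'S_n) (i j : 'I_n) : i < j ->
  reflect (exists2 k : 'I_n, i < k <= j & s i < s k) (to231 s i < to231 s j).
Proof.
move=> ij; have ji : rev_perm n j < rev_perm n i by rewrite rev_perm_lt.
rewrite !permM perm_ltN; last by rewrite ltn_ord_neq.
rewrite to132E // /record_from negb_forall.
have rr k : rev_perm n (rev_perm n k) = k by rewrite -permM rev_permK perm1.
have le_rev (a b : 'I_n) : (rev_perm n a <= rev_perm n b) = (b <= a).
  by rewrite leqNgt rev_perm_lt -leqNgt.
apply: (iffP existsP) => [[k]|[k /andP[ik kj] sik]].
  rewrite negb_imply !permM rr -leqNgt => /andP[/andP[jk ki] sik].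
  exists (rev_perm n k); first by rewrite -rev_perm_lt rr ki /= -le_rev rr.
  rewrite ltn_neqAle sik andbT (inj_eq val_inj) (inj_eq perm_inj) -(inj_eq (@perm_inj _ (rev_perm n))) rr.
  by rewrite eq_sym ltn_ord_neq.
exists (rev_perm n k); rewrite negb_imply le_rev kj rev_perm_lt ik /= !permM !rr -leqNgt.
exact: ltnW.
Qed.

Lemma record_from_to132 n (s : 'S_n) : record_from (to132 s) =2 record_from s.
Proof.
move=> i j; apply/record_fromP/record_fromP => u k kij; have /andP[ik kj] := kij.
  by move: (u k kij); rewrite to132E // => /record_fromP; apply; rewrite leqnn.
rewrite to132E //; apply/record_fromP => l /andP[kl lj].
by apply: u; rewrite lj (leq_trans ik).
Qed.

(** If [s j] were not the maximum of the interval, the entry [m] holding the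
    maximum would have no larger entry after it up to [j], so [to231 s] could
    not ascend from [m] to [j]. *)
Lemma record_from_to231 n (s : 'S_n) : record_from (to231 s) =2 record_from s.
Proof.
move=> i j; apply/record_fromP/record_fromP => u k kij; have /andP[ik kj] := kij; last first.
  by apply/to231P => //; exists j; rewrite ?kj ?leqnn //; apply: u.
have ij := leq_ltn_trans ik kj.
pose Q (l : 'I_n) := i <= l <= j.
have Qj : Q j by rewrite /Q leqnn (ltnW ij).
case: (@arg_maxnP _ j Q (fun l => s l) Qj) => m /andP[im mj] mmax.
have mjE : m = j.
  apply/eqP; rewrite -(inj_eq val_inj); move: mj; rewrite leq_eqVlt => /orP[//|mj].
  have /(u m) : i <= m < j by rewrite im.
  move=> /to231P-/(_ mj) [l /andP[ml lj]].
  by rewrite ltnNge [_ <= _](mmax l _) // /Q lj (leq_trans im (ltnW ml)).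
have := mmax k; rewrite /Q ik (ltnW kj) => /(_ isT); rewrite mjE => skj.
by rewrite ltn_neqAle [_ <= _]skj (inj_eq val_inj) (inj_eq perm_inj) ltn_ord_neq.
Qed.

Lemma eq_to132 n (s t : 'S_n) :
  record_from s =2 record_from t -> to132 s = to132 t.
Proof. by move=> st; apply: perm_ascents_inj => i j ij; rewrite !to132E. Qed.

(** Each retraction depends only on the shape, and keeps it, so it absorbs a
    previous application of the other one. *)
Lemma to132_to231 n (s : 'S_n) : to132 (to231 s) = to132 s.
Proof. exact/eq_to132/record_from_to231. Qed.

Lemma to231_to132 n (s : 'S_n) : to231 (to132 s) = to231 s.
Proof.
(* Reversal exchanges the two retractions. *)
have -> : to132 s = (rev_perm n * to231 (rev_perm n * s))%g by rewrite /to231 !mulgA rev_permK !mul1g.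
by rewrite /to231 mulgA rev_permK mul1g to132_to231.
Qed.

(** * Avoidance as a fixed-point condition *)

Lemma contains3P n (s : 'S_n) (p : 'S_3) :
  reflect (exists i j k : 'I_n,
             [/\ i < j < k, (s i < s j) = (p v1 < p v2),
              (s i < s k) = (p v1 < p v3) & (s j < s k) = (p v2 < p v3)])
          (contains s p).
Proof.
apply: (iffP (containsP s p)) => [[f fM fP]|[i [j [k [/andP[ij jk] pij pik pjk]]]]].
  by exists (f v1), (f v2), (f v3); rewrite !fM // !fP.
have ik := ltn_trans ij jk.
exists (fun x : 'I_3 => if val x is x'.+1 then if x' is 0 then j else k else i).
  by move=> [[|[|[|//]]] ?] [[|[|[|//]]] ?].
have e1 h : @Ordinal 3 0 h = v1 by apply: val_inj.
have e2 h : @Ordinal 3 1 h = v2 by apply: val_inj.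
have e3 h : @Ordinal 3 2 h = v3 by apply: val_inj.
move=> [[|[|[|//]]] ?] [[|[|[|//]]] ?] /=; rewrite ?e1 ?e2 ?e3 ?ltnn //.
- by rewrite perm_ltN // -pij -perm_ltN // ltn_ord_neq.
- by rewrite perm_ltN // -pik -perm_ltN // ltn_ord_neq.
- by rewrite perm_ltN // -pjk -perm_ltN // ltn_ord_neq.
Qed.

(** If [s i < s j] but the entry at [j] is no record from [i], then some entry
    between them exceeds both, and the three form a 132.  Conversely, in
    [to132 s] an entry that exceeds the one at [i] exceeds all those after [i]
    as well, so it cannot be the last one of a 132. *)
Lemma Av132E n (s : 'S_n) : (s \in Av n s132) = (to132 s == s).
Proof.
rewrite inE; apply/idP/eqP => [s_av|<-].
  apply: perm_ascents_inj => i j ij; rewrite to132E //.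
  apply/record_fromP/idP => [|sij k /andP[ik kj]]; first by apply; rewrite leqnn.
  apply: contraNT s_av; rewrite -leqNgt => sjk; apply/contains3P.
  have sjk' : s j < s k.
    by rewrite ltn_neqAle sjk (inj_eq val_inj) (inj_eq perm_inj) eq_sym ltn_ord_neq.
  have sik := ltn_trans sij sjk'.
  have ik' : i < k.
    by rewrite ltn_neqAle ik andbT; apply: contraTneq sik => /val_inj ->; rewrite ltnn.
  exists i, k, j; rewrite !permE /= ik' kj sij sik [_ < _ in RHS]/=; split=> //.
  by apply/negbTE; rewrite -leqNgt.
apply/contains3P => -[i [j [k [/andP[ij jk]]]]]; rewrite !permE /= => _.
rewrite !to132E ?(ltn_trans ij jk) // => uik.
suff -> : record_from s j k by [].
apply/record_fromP => l /andP[jl lk]; move/record_fromP: uik; apply.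
by rewrite lk (leq_trans (ltnW ij)).
Qed.

Lemma contains_reverse n k (s : 'S_n) (p : 'S_k) :
  contains s p -> contains (rev_perm n * s)%g (rev_perm k * p)%g.
Proof.
move=> /containsP[f fM fP]; apply/containsP.
exists (fun i => rev_perm n (f (rev_perm k i))) => i j; first by rewrite -rev_perm_lt => /fM; rewrite rev_perm_lt.
by rewrite !permM fP -!(permM (rev_perm n) (rev_perm n)) rev_permK !perm1.
Qed.

Lemma contains_complement n k (s : 'S_n) (p : 'S_k) :
  contains s p -> contains (s * rev_perm n)%g (p * rev_perm k)%g.
Proof.
move=> /containsP[f fM fP]; apply/containsP; exists f => // i j.
by rewrite !permM !rev_perm_lt.
Qed.

Lemma Av_reverse n k (s : 'S_n) (p : 'S_k) :
  ((rev_perm n * s)%g \in Av n (rev_perm k * p)%g) = (s \in Av n p).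
Proof.
rewrite !inE; congr (~~ _); apply/idP/idP => /contains_reverse //.
by rewrite !mulgA !rev_permK !mul1g.
Qed.

Lemma Av_complement n k (s : 'S_n) (p : 'S_k) :
  ((s * rev_perm n)%g \in Av n (p * rev_perm k)%g) = (s \in Av n p).
Proof.
rewrite !inE; congr (~~ _); apply/idP/idP => /contains_complement //.
by rewrite -!mulgA !rev_permK !mulg1.
Qed.

Lemma reverse231 : s132 = (rev_perm 3 * s231)%g.
Proof. by apply/permP => -[[|[|[|//]]] ?]; rewrite permM !permE; apply/val_inj. Qed.
Lemma complement132 : s132 = (s312 * rev_perm 3)%g.
Proof. by apply/permP => -[[|[|[|//]]] ?]; rewrite permM !permE; apply/val_inj. Qed.
Lemma complement231 : s231 = (s213 * rev_perm 3)%g.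
Proof. by apply/permP => -[[|[|[|//]]] ?]; rewrite permM !permE; apply/val_inj. Qed.

Lemma Av231E n (s : 'S_n) : (s \in Av n s231) = (to231 s == s).
Proof.
rewrite -Av_reverse -reverse231 Av132E -(inj_eq (mulgI (rev_perm n))).
by rewrite mulgA rev_permK mul1g.
Qed.

(** * Equality of the maj polynomials *)

Definition same_descents n (s t : 'S_n) :=
  forall i j : 'I_n, j = i.+1 :> nat -> (s i < s j) = (t i < t j).

Lemma nth_oneline n (s : 'S_n) (i : 'I_n) : nth 0 (oneline s) i = (s i).+1.
Proof. by rewrite (nth_map i) ?size_enum_ord // nth_ord_enum. Qed.

Lemma same_descents_maj n (s t : 'S_n) : same_descents s t -> maj s = maj t.
Proof.
move=> st; rewrite /maj big_nat_cond [RHS]big_nat_cond; apply: eq_bigl => -[|i] //=.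
case: ltnP => //= lt_in.
have lt_in' := ltnW lt_in.
have eS u : nth 0 (oneline u) i.+1 = (u (Ordinal lt_in)).+1 := nth_oneline u (Ordinal lt_in).
have e u : nth 0 (oneline u) i = (u (Ordinal lt_in')).+1 := nth_oneline u (Ordinal lt_in').
rewrite !eS !e !ltnS.
have iD : Ordinal lt_in' != Ordinal lt_in by apply: ltn_ord_neq => /=.
by rewrite perm_ltN // st // -perm_ltN.
Qed.

Lemma same_descents_to132 n (s : 'S_n) : same_descents (to132 s) s.
Proof.
move=> i j ji; rewrite to132E ?ji //; apply/record_fromP/idP => [|sij k].
  by apply; rewrite leqnn ji /=.
by rewrite ji ltnS -eqn_leq => /eqP/val_inj <-.
Qed.

Lemma same_descents_complement n (s t : 'S_n) :
  same_descents s t -> same_descents (s * rev_perm n)%g (t * rev_perm n)%g.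
Proof.
move=> st i j ji; rewrite !permM !rev_perm_lt.
by rewrite perm_ltN ?[RHS]perm_ltN ?st // ltn_ord_neq // ji.
Qed.

(** Two idempotents with [a \o b = a] and [b \o a = b] restrict to mutually
    inverse bijections between their sets of fixed points. *)
Lemma M_eq_retractions n k l (p : 'S_k) (p' : 'S_l) (a b : 'S_n -> 'S_n) :
    (forall s, (s \in Av n p) = (a s == s)) ->
    (forall s, (s \in Av n p') = (b s == s)) ->
    (forall s, a (b s) = a s) -> (forall s, b (a s) = b s) ->
    (forall s, same_descents (a s) s) ->
  M n p = M n p'.
Proof.
move=> pE p'E ab ba aD; rewrite /M.
rewrite (reindex_onto a b) => [|s]; last by rewrite pE ab => /eqP.
apply: eq_big => [s|s _]; last by rewrite (same_descents_maj (aD s)).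
by rewrite pE p'E ba -{1}ab ba ab eqxx.
Qed.

Lemma M132_231 n : M n s132 = M n s231.
Proof.
apply: (@M_eq_retractions n 3 3 _ _ (@to132 n) (@to231 n)).
- exact: Av132E.
- exact: Av231E.
- exact: to132_to231.
- exact: to231_to132.
- exact: same_descents_to132.
Qed.

(** The retractions onto the avoiders of 312 and 213 are the conjugates by
    complementation of those onto the avoiders of 132 and 231; complementation
    does not keep maj, but it sends equal descent sets to equal ones. *)
Lemma M312_213 n : M n s312 = M n s213.
Proof.
have cK (s : 'S_n) : (s * rev_perm n * rev_perm n)%g = s by rewrite -mulgA rev_permK mulg1.
apply: (@M_eq_retractions n 3 3 _ _ (fun s => to132 (s * rev_perm n) * rev_perm n)%g
                                   (fun s => to231 (s * rev_perm n) * rev_perm n)%g) => s.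
- by rewrite -Av_complement -complement132 Av132E -(inj_eq (mulIg (rev_perm n))) cK.
- by rewrite -Av_complement -complement231 Av231E -(inj_eq (mulIg (rev_perm n))) cK.
- by rewrite cK to132_to231.
- by rewrite cK to231_to132.
- rewrite -{2}[s]cK; exact/same_descents_complement/same_descents_to132.
Qed.

(** * Size and major index are invariants *)

Lemma contains_leq n k (s : 'S_n) (p : 'S_k) : contains s p -> k <= n.
Proof.
move=> /containsP[f fM _]; rewrite -(card_ord k) -(card_ord n).
apply: (@leq_card _ _ f) => i j e; apply/val_inj.
by case: (ltngtP i j) => // /fM; rewrite e ltnn.
Qed.

(** The only strictly increasing map from [n] positions to [n] positions is the
    identity. *)
Lemma contains_eq n (s p : 'S_n) : contains s p = (s == p).
Proof.
apply/containsP/eqP => [[f fM fP]|->]; last by exists id.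
have f_inj : injective f.
  by move=> i j e; apply/val_inj; case: (ltngtP i j) => // /fM; rewrite e ltnn.
have f1 : perm f_inj = 1%g.
  apply: perm_ascents_inj => i j ij.
  by rewrite !permE ij fM.
apply/esym/perm_order_inj => i j.
by rewrite fP -!(permE f_inj) f1 !permE.
Qed.

Lemma M_short n k (p : 'S_k) : n < k -> M n p = (\sum_(s : 'S_n) 'X^(maj s))%R.
Proof.
move=> nk; apply: eq_bigl => s; rewrite inE.
by apply/negP => /contains_leq; rewrite leqNgt nk.
Qed.

Lemma M_diag n (p : 'S_n) : (M n p + 'X^(maj p))%R = (\sum_(s : 'S_n) 'X^(maj s))%R.
Proof.
rewrite (bigD1 p) //= GRing.addrC; congr (_ + _)%R.
by apply: eq_bigl => s; rewrite inE contains_eq.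
Qed.

(** If [p'] were longer than [p], then at the size of [p] the polynomial of [p]
    would lack a monomial and that of [p'] would not. *)
Lemma maj_wilf_tag_leq (p p' : permutation) : maj_wilf p p' -> tag p' <= tag p.
Proof.
case: p p' => [k p] [l p'] pp' /=; rewrite leqNgt; apply/negP => kl.
have := M_diag p; rewrite (pp' k) (M_short p' kl) -[RHS]GRing.addr0 => /GRing.addrI/eqP.
by rewrite -size_poly_eq0 size_polyXn.
Qed.

Lemma maj_wilf_sym (p p' : permutation) : maj_wilf p p' -> maj_wilf p' p.
Proof. by move=> pp' n; rewrite pp'. Qed.

Lemma maj_wilf_maj n (p p' : 'S_n) : maj_wilf (perm_in p) (perm_in p') -> maj p = maj p'.
Proof.
move=> pp'; have := M_diag p; rewrite -(M_diag p') (pp' n) => /GRing.addrI.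
by move=> /(congr1 (fun q : {poly int} => size q)); rewrite !size_polyXn => -[].
Qed.

Lemma maj_classP n (p : 'S_n) (q : permutation) : maj_class (perm_in p) q ->
  exists2 p' : 'S_n, q = perm_in p' & maj p = maj p'.
Proof.
case: q => [m q] pq.
have nm : n = m.
  apply/eqP; rewrite eqn_leq (maj_wilf_tag_leq pq).
  by rewrite (maj_wilf_tag_leq (maj_wilf_sym pq)).
by case: m / nm q pq => q pq; exists q => //; apply: maj_wilf_maj.
Qed.

(** * The classes of the permutations in S_3 *)

Lemma S3_ind (P : 'S_3 -> Prop) :
  P s123 -> P s132 -> P s213 -> P s231 -> P s312 -> P s321 -> forall p, P p.
Proof.
move=> P1 P2 P3 P4 P5 P6 p.
have sE (q : 'S_3) : p v1 = q v1 -> p v2 = q v2 -> p v3 = q v3 -> p = q.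
  move=> e1 e2 e3; apply/permP => -[[|[|[|//]]] i].
  - by rewrite (_ : Ordinal i = v1) //; apply: val_inj.
  - by rewrite (_ : Ordinal i = v2) //; apply: val_inj.
  - by rewrite (_ : Ordinal i = v3) //; apply: val_inj.
have v_cases (x : 'I_3) : [\/ x = v1, x = v2 | x = v3].
  by case: x => [[|[|[|//]]] i]; [constructor 1|constructor 2|constructor 3]; apply: val_inj.
have d12 : p v1 <> p v2 by move/perm_inj.
have d13 : p v1 <> p v3 by move/perm_inj.
have d23 : p v2 <> p v3 by move/perm_inj.
case: (v_cases (p v1)) => e1; case: (v_cases (p v2)) => e2; case: (v_cases (p v3)) => e3;
  rewrite ?e1 ?e2 ?e3 // in d12 d13 d23.
- by rewrite (sE s123) // ?e1 ?e2 ?e3 permE; apply: val_inj.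
- by rewrite (sE s132) // ?e1 ?e2 ?e3 permE; apply: val_inj.
- by rewrite (sE s213) // ?e1 ?e2 ?e3 permE; apply: val_inj.
- by rewrite (sE s231) // ?e1 ?e2 ?e3 permE; apply: val_inj.
- by rewrite (sE s312) // ?e1 ?e2 ?e3 permE; apply: val_inj.
- by rewrite (sE s321) // ?e1 ?e2 ?e3 permE; apply: val_inj.
Qed.

Lemma maj_S3 :
  [/\ maj s123 = 0, maj s132 = 2 & maj s213 = 1] /\
  [/\ maj s231 = 2, maj s312 = 1 & maj s321 = 3].
Proof.
have [[e1 e2 e3] [e4 e5 e6]] := oneline_S3.
by split; split; rewrite /maj ?e1 ?e2 ?e3 ?e4 ?e5 ?e6 unlock.
Qed.

Theorem theorem2p6 :
  [/\ maj_class p123 = [set p123],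
      maj_class p321 = [set p321],
      maj_class p132 = [set p132; p231],
      maj_class p213 = [set p213; p312]
    & [set C : set permutation | exists p : 'S_3, C = maj_class (perm_in p)]
      = [set [set p123]; [set p321]; [set p132; p231]; [set p213; p312]]].
Proof.
have [[m1 m2 m3] [m4 m5 m6]] := maj_S3.
have c123 : maj_class p123 = [set p123].
  apply/seteqP; split=> q; last by move=> ->.
  by move=> /maj_classP[p ->]; elim/S3_ind: p; rewrite m1 ?m2 ?m3 ?m4 ?m5 ?m6.
have c321 : maj_class p321 = [set p321].
  apply/seteqP; split=> q; last by move=> ->.
  by move=> /maj_classP[p ->]; elim/S3_ind: p; rewrite m6 ?m2 ?m3 ?m4 ?m5 ?m1.
have c132 : maj_class p132 = [set p132; p231].
  apply/seteqP; split=> q; last by move=> [] -> // n; apply: M132_231.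
  move=> /maj_classP[p ->].
  by elim/S3_ind: p; rewrite m2 ?m1 ?m3 ?m4 ?m5 ?m6 // => _; [left|right].
have c213 : maj_class p213 = [set p213; p312].
  apply/seteqP; split=> q; last by move=> [] -> // n; apply/esym/M312_213.
  move=> /maj_classP[p ->].
  by elim/S3_ind: p; rewrite m3 ?m1 ?m2 ?m4 ?m5 ?m6 // => _; [left|right].
have class_eq p q : maj_wilf p q -> maj_class p = maj_class q.
  by move=> pq; apply/seteqP; split=> r pr n; rewrite -(pr n) (pq n).
have c231 : maj_class p231 = [set p132; p231].
  by rewrite -c132; apply/esym/class_eq => n; apply: M132_231.
have c312 : maj_class p312 = [set p213; p312].
  by rewrite -c213; apply/class_eq => n; apply: M312_213.
split=> //; apply/seteqP; split=> C.
  move=> [p ->].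
  elim/S3_ind: p; rewrite ?[maj_class _]c123 ?[maj_class _]c132 ?[maj_class _]c213
    ?[maj_class _]c231 ?[maj_class _]c312 ?[maj_class _]c321 /=; tauto.
by move=> [[[]|]|] ->; [rewrite -c123|rewrite -c321|rewrite -c132|rewrite -c213]; eexists.
Qed.
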